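(* Let $\lambda$ be a real number. For every integer $n\ge 0$, $$(x)_{n,\lambda}=\sum_{k=0}^{n}\beta_{k,\lambda}(x)\,S_{1,\lambda}(n,k),$$ where $(x)_{n,\lambda}$ is the $\lambda$-falling factorial, $\beta_{k,\lambda}(x)$ are the fully degenerate Bell polynomials and $S_{1,\lambda}(n,k)$ are the degenerate Stirling numbers of the first kind (all defined in the context).
   Context: The $\lambda$-falling factorial is $(x)_{0,\lambda}=1$, $(x)_{n,\lambda}=x(x-\lambda)\cdots(x-(n-1)\lambda)$ for $n\ge1$. The degenerate exponential function is $e_\lambda^x(t)=\sum_{n\ge0}(x)_{n,\lambda}\frac{t^n}{n!}$ $(=(1+\lambda t)^{x/\lambda})$, and $e_\lambda(t)=e_\lambda^1(t)$. Its compositional inverse satisfies $\log_\lambda(1+t)=\frac{1}{\lambda}\big((1+t)^\lambda-1\big)=\sum_{n\ge1}\lambda^{n-1}(1)_{n,1/\lambda}\frac{t^n}{n!}$ (for $\lambda=0$ these are understood as $e^{xt}$ and $\log(1+t)$). The degenerate Stirling numbers of the first kind are defined by $\frac{1}{k!}(\log_\lambda(1+t))^k=\sum_{n\ge k}S_{1,\lambda}(n,k)\frac{t^n}{n!}$ (with $S_{1,\lambda}(n,k)=0$ for $k>n$). The fully degenerate Bell polynomials $\beta_{n,\lambda}(x)$ are defined by $e_\lambda^x\big(e_\lambda(t)-1\big)=\sum_{n\ge0}\beta_{n,\lambda}(x)\frac{t^n}{n!}$. Identities are understood as identities of formal power series / polynomials in $x$. *)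

(* Defs.v *)
From mathcomp Require Import all_boot all_order all_algebra.
From mathcomp Require Import reals.

Set Implicit Arguments.
Unset Strict Implicit.
Unset Printing Implicit Defensive.

Import GRing.Theory.
Local Open Scope ring_scope.

(* A formal power series [\sum_n f_n t^n] over a commutative
   ring [A] is encoded by its sequence of coefficients [f : nat -> A]. *)
Section FormalPowerSeries.
Variable A : comNzRingType.
Implicit Types f g : nat -> A.

Definition fps_one : nat -> A := fun n => (n == 0%N)%:R.

Definition fps_sub f g : nat -> A := fun n => f n - g n.

Definition fps_mul f g : nat -> A :=
  fun n => \sum_(i < n.+1) f i * g (n - i)%N.

Definition fps_exp f (k : nat) : nat -> A := iter k (fps_mul f) fps_one.

(* The composite [f(g(t))], meaningful only when [g 0 = 0]: then [g^k] has no
   term of degree less than [k], so the coefficient of [t^n] in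
   [\sum_k f_k g^k] only involves the indices [k <= n]. *)
Definition fps_comp f g : nat -> A :=
  fun n => \sum_(k < n.+1) f k * fps_exp g k n.

Definition falling (lam x : A) (n : nat) : A := \prod_(i < n) (x - lam *+ i).

End FormalPowerSeries.

Section Degenerate.
Variable R : realType.
Implicit Type lam : R.

(* [e_lam^x(t)], as a series in [t] whose coefficients are polynomials in an
   indeterminate; the exponent [x] is itself a polynomial (['X] or [1] below).
   For [lam = 0] this is literally [e^(x t)]. *)
Definition deg_exp lam (x : {poly R}) : nat -> {poly R} :=
  fun n => (n`!%:R)^-1 *: falling lam%:P x n.

(* [log_lam(1 + t)].  The case [lam = 0] is the series of [log(1 + t)]; it has
   to be separated since [lam^-1 = 0] there by convention. *)
Definition deg_log1p lam : nat -> R := fun n =>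
  if n is m.+1 then
    if lam == 0 then (-1) ^+ m / n%:R
    else lam ^+ m * falling lam^-1 1 n / n`!%:R
  else 0.

(* Zero for [k > n], as [deg_log1p lam] has no constant term. *)
Definition deg_stirling1 lam (n k : nat) : R :=
  n`!%:R * ((k`!%:R)^-1 * fps_exp (deg_log1p lam) k n).

Definition deg_bell lam (n : nat) : {poly R} :=
  n`!%:R *: fps_comp (deg_exp lam 'X)
                     (fps_sub (deg_exp lam 1) (fps_one {poly R})) n.

End Degenerate.

(* Main.v *)
(* Writing [E(t) = e_lam^x(t)], [u(t) = e_lam(t) - 1] and
   [L(t) = log_lam(1 + t)], the right-hand side is [n!] times the coefficient
   of [t^n] in [(E o u) o L], and the claim is [(E o u) o L = E].  Since
   composition is associative it suffices that [u o L = t].  The equations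
   [(1 + lam t) e' = e] and [(1 + t) L' = 1 + lam L], valid also for [lam = 0],
   give [(1 + t) g' = g] for [g = e_lam o L], whence [g = 1 + t].
   Power series are manipulated through polynomials modulo ['X^N]. *)
Require Import Defs.
From mathcomp Require Import all_boot all_order all_algebra.
From mathcomp Require Import reals.

Import GRing.Theory Num.Theory.
Local Open Scope ring_scope.

(** * Polynomials modulo ['X^N] *)

Section TakePoly.
Variable A : comNzRingType.
Implicit Types p q r : {poly A}.

Lemma eq_take_polyP N p q :
  take_poly N p = take_poly N q <-> forall i, (i < N)%N -> p`_i = q`_i.
Proof.
split=> [eq_pq i ltiN | eq_pq].
  by have := congr1 (fun s : {poly A} => s`_i) eq_pq; rewrite !coef_take_poly ltiN.
by apply/polyP => i; rewrite !coef_take_poly; case: ifP => // /eq_pq.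
Qed.

Lemma take_polyMl N p q : take_poly N (take_poly N p * q) = take_poly N (p * q).
Proof.
rewrite -[p in RHS](poly_take_drop N) mulrDl take_polyD mulrAC.
by rewrite take_polyMXn_0 addr0.
Qed.

Lemma take_polyMr N p q : take_poly N (p * take_poly N q) = take_poly N (p * q).
Proof. by rewrite mulrC take_polyMl mulrC. Qed.

(** A [q] without constant term is a multiple of ['X], so ['X^N \Po q], that is [q ^+ N], is
    divisible by ['X^N]. The part of [p] of degree at least [N] therefore stays invisible below [N]
    after substitution. *)
Lemma take_poly_comp N p p' q : q`_0 = 0 ->
  take_poly N p = take_poly N p' ->
  take_poly N (p \Po q) = take_poly N (p' \Po q).
Proof.
move=> q0 eqp; rewrite -[p](poly_take_drop N) -[p'](poly_take_drop N) eqp.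
have /factor_theorem[s qE] : root q 0 by rewrite /root horner_coef0 q0.
rewrite !comp_polyD !comp_polyM !rmorphXn /= comp_polyX {3 6}qE polyC0 subr0.
by rewrite exprMn !mulrA !take_polyD !take_polyMXn_0.
Qed.

Lemma take_poly_exp N p q k : take_poly N p = take_poly N q ->
  take_poly N (p ^+ k) = take_poly N (q ^+ k).
Proof.
move=> eqpq; elim: k => [|k IHk]; first by rewrite !expr0.
by rewrite !exprS -take_polyMl -take_polyMr eqpq IHk take_polyMl take_polyMr.
Qed.

Lemma take_poly_compr N p q q' : take_poly N q = take_poly N q' ->
  take_poly N (p \Po q) = take_poly N (p \Po q').
Proof.
move=> eqq; rewrite !comp_polyE !take_poly_sum; apply: eq_bigr => i _.
by rewrite !take_polyZ (take_poly_exp _ _ _ _ eqq).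
Qed.

Lemma coef_exp_lt p k n : p`_0 = 0 -> (n < k)%N -> (p ^+ k)`_n = 0.
Proof.
move=> p0 ltnk; have /factor_theorem[s ->] : root p 0.
  by rewrite /root horner_coef0 p0.
by rewrite polyC0 subr0 exprMn coefMXn ltnk.
Qed.

End TakePoly.

(** * Power series and their truncations *)

Section FormalPowerSeries.
Variable A : comNzRingType.
Implicit Types f g h : nat -> A.

Definition fps_trunc N f : {poly A} := \poly_(i < N) f i.

Lemma coef_fps_trunc N f i : (i < N)%N -> (fps_trunc N f)`_i = f i.
Proof. by move=> ltiN; rewrite coef_poly ltiN. Qed.

Lemma fps_trunc0 N f : f 0%N = 0 -> (fps_trunc N f)`_0 = 0.
Proof. by rewrite coef_poly => ->; case: ifP. Qed.

Lemma coef_fps_exp N f k i : (i < N)%N ->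
  (fps_trunc N f ^+ k)`_i = fps_exp f k i.
Proof.
elim: k i => [|k IHk] i ltiN; first by rewrite expr0 coef1.
rewrite exprS coefM; apply: eq_bigr => j _.
rewrite IHk ?(leq_ltn_trans (leq_subr _ _)) // coef_fps_trunc //.
exact: leq_ltn_trans (leq_ord j) ltiN.
Qed.

Lemma coef_fps_comp N f g i : g 0%N = 0 -> (i < N)%N ->
  (fps_trunc N f \Po fps_trunc N g)`_i = fps_comp f g i.
Proof.
move=> g0 ltiN; set F := fps_trunc N f; set G := fps_trunc N g.
have sF : (size F <= N)%N by apply: size_poly.
(* The two sums stop at different bounds, [size F] and [i.+1]; both are widened to [N]. The added
   terms vanish, by the size of [F] in the first and because [G ^+ k] starts in degree at least [k]
   in the second. *)
rewrite coef_comp_poly (big_ord_widen _ (fun k => F`_k * (G ^+ k)`_i) sF).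
rewrite /fps_comp (big_ord_widen _ (fun k => f k * fps_exp g k i) ltiN).
rewrite big_mkcond [RHS]big_mkcond; apply: eq_bigr => k _ /=.
rewrite -(coef_fps_trunc N f) // -/F -(coef_fps_exp N) // -/G.
case: ltnP => [_|leFk]; last by rewrite nth_default ?mul0r ?if_same.
by case: ltnP => // ltik; rewrite coef_exp_lt ?mulr0 // fps_trunc0.
Qed.

Lemma fps_trunc_comp N f g : g 0%N = 0 ->
  take_poly N (fps_trunc N (fps_comp f g)) =
  take_poly N (fps_trunc N f \Po fps_trunc N g).
Proof.
by move=> g0; apply/eq_take_polyP => i ltiN; rewrite coef_fps_trunc ?coef_fps_comp.
Qed.

Lemma eq_fps_exp f g k : f =1 g -> fps_exp f k =1 fps_exp g k.
Proof.
move=> eqfg; elim: k => // k IHk n.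
by apply: eq_bigr => i _; rewrite eqfg; congr (_ * _); apply: IHk.
Qed.

Lemma eq_fps_compr f g h : g =1 h -> fps_comp f g =1 fps_comp f h.
Proof.
by move=> eqgh n; apply: eq_bigr => k _; rewrite (eq_fps_exp _ _ _ eqgh).
Qed.

Lemma fps_comp0 f g : g 0%N = 0 -> fps_comp f g 0%N = f 0%N.
Proof. by move=> g0; rewrite /fps_comp big_ord1 mulr1. Qed.

(** Coefficient [n] depends only on truncations at order [n.+1], where the claim becomes
    associativity of polynomial composition. *)
Lemma fps_compA f g h : g 0%N = 0 -> h 0%N = 0 ->
  fps_comp (fps_comp f g) h =1 fps_comp f (fps_comp g h).
Proof.
move=> g0 h0 n; have gh0 : fps_comp g h 0%N = 0 by rewrite fps_comp0.
rewrite -(coef_fps_comp n.+1 _ h) // -(coef_fps_comp n.+1 f) //.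
suff /eq_take_polyP : take_poly n.+1 (fps_trunc n.+1 (fps_comp f g) \Po fps_trunc n.+1 h) =
    take_poly n.+1 (fps_trunc n.+1 f \Po fps_trunc n.+1 (fps_comp g h)) by apply.
rewrite (take_poly_compr _ _ _ _ _ (fps_trunc_comp _ _ _ h0)) comp_polyA.
exact: take_poly_comp _ _ _ _ _ (fps_trunc0 _ _ h0) (fps_trunc_comp _ _ _ g0).
Qed.

Lemma fps_compX f : fps_comp f (fun n => (n == 1%N)%:R) =1 f.
Proof.
move=> n; set t := fun n => _.
(* Order [n.+2] keeps the term of degree 1 of the series [t] even when [n] is 0. *)
rewrite -(@coef_fps_comp n.+2) //.
have -> : fps_trunc n.+2 t = 'X.
  by apply/polyP => -[|[|i]]; rewrite coef_poly coefX //= if_same.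
by rewrite comp_polyXr coef_fps_trunc.
Qed.

Lemma fps_comp_sub f g h n :
  fps_comp (fps_sub f g) h n = fps_comp f h n - fps_comp g h n.
Proof.
by rewrite /fps_comp -sumrB; apply: eq_bigr => k _; rewrite mulrBl.
Qed.

Lemma fps_comp_one g : fps_comp (fps_one A) g =1 fps_one A.
Proof.
move=> n; rewrite /fps_comp big_ord_recl /= mul1r big1 ?addr0 // => k _.
by rewrite mul0r.
Qed.

(* The hypotheses say [(1 + c t) e' = e] and [(1 + t) l' = 1 + c l]; the
   conclusion is [(1 + t) g' = g] for [g = e o l]. *)
Lemma fps_comp_exp_log (c : A) e l :
    (forall n, e n.+1 *+ n.+1 + c * e n *+ n = e n) ->
    l 0%N = 0 ->
    (forall n, l n.+1 *+ n.+1 + l n *+ n = (n == 0%N)%:R + c * l n) ->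
  forall n,
    fps_comp e l n.+1 *+ n.+1 + fps_comp e l n *+ n = fps_comp e l n.
Proof.
(* Differentiation costs one degree, hence truncation at [n.+2] for identities modulo ['X^n.+1]. *)
move=> De l0 Dl n; set E := fps_trunc n.+2 e; set L := fps_trunc n.+2 l.
have L0 : L`_0 = 0 by apply: fps_trunc0.
have coefXD p i : (p^`() * 'X)`_i = p`_i *+ i :> A.
  by rewrite coefMX; case: i => [|i] //=; rewrite coef_deriv.
have DE : take_poly n.+1 (E^`() * (1 + c *: 'X)) = take_poly n.+1 E.
  apply/eq_take_polyP => i ltin.
  rewrite mulrDr mulr1 -scalerAr coefD coefZ coefXD coef_deriv.
  by rewrite !coef_fps_trunc ?(leqW ltin) // mulrnAr De.
have DL : take_poly n.+1 (L^`() * (1 + 'X)) = take_poly n.+1 (1 + c *: L).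
  apply/eq_take_polyP => i ltin.
  rewrite mulrDr mulr1 !coefD coefZ coef1 coefXD coef_deriv.
  by rewrite !coef_fps_trunc ?(leqW ltin) // Dl.
have /eq_take_polyP/(_ n (ltnSn n)) : take_poly n.+1 ((E \Po L)^`() * (1 + 'X)) =
    take_poly n.+1 (E \Po L).
  rewrite deriv_comp -mulrA -take_polyMr DL take_polyMr.
  rewrite -(take_poly_comp _ _ _ _ _ L0 DE) comp_polyM comp_polyD comp_polyZ.
  by rewrite comp_polyX comp_polyC.
rewrite mulrDr mulr1 coefD coefXD coef_deriv !coef_fps_comp //.
Qed.

End FormalPowerSeries.

(** The logarithm has scalar coefficients but is composed with series over polynomials; this
    recovers the scalar Stirling numbers. *)
Lemma fps_exp_polyC (A : comNzRingType) (f : nat -> A) k n :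
  fps_exp (fun i => (f i)%:P) k n = (fps_exp f k n)%:P.
Proof.
elim: k n => [|k IHk] n; first by rewrite /= /fps_one polyC_natr.
rewrite /= /fps_mul rmorph_sum /=; apply: eq_bigr => i _.
by rewrite IHk polyCM.
Qed.

Lemma fact_neq0 (R : numDomainType) n : n`!%:R != 0 :> R.
Proof. by rewrite pnatr_eq0 -lt0n fact_gt0. Qed.

(** * Degenerate exponential and logarithm *)

Section Degenerate.
Variables (R : realType) (lam : R).

Lemma deg_expS (x : {poly R}) n :
  deg_exp lam x n.+1 *+ n.+1 = (x - lam%:P *+ n) * deg_exp lam x n.
Proof.
rewrite /deg_exp /falling big_ord_recr /= scalerMnl -scalerAr [in RHS]mulrC.
congr (_ *: _); rewrite factS natrM invfM -mulrnAl -mulr_natr.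
by rewrite mulVf ?mul1r // pnatr_eq0.
Qed.

Lemma deg_exp1_ode n :
  deg_exp lam 1 n.+1 *+ n.+1 + lam%:P * deg_exp lam 1 n *+ n = deg_exp lam 1 n.
Proof. by rewrite deg_expS mulrBl mul1r mulrnAl subrK. Qed.

Lemma deg_exp0 x : deg_exp lam x 0 = 1.
Proof. by rewrite /deg_exp /falling big_ord0 invr1 scale1r. Qed.

Lemma deg_log1pE n :
  deg_log1p lam n.+1 = (\prod_(i < n) (lam - i.+1%:R)) / n.+1`!%:R.
Proof.
rewrite /deg_log1p; case: eqVneq => [->|lam0].
  have -> : \prod_(i < n) (0 - i.+1%:R) = (-1) ^+ n * n`!%:R :> R.
    elim: n => [|n IHn]; first by rewrite big_ord0 expr0 mulr1.
    rewrite big_ord_recr /= IHn factS natrM exprSr mulrN1 mulNr sub0r mulrN.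
    by rewrite -mulrA [n`!%:R * _]mulrC.
  by rewrite factS natrM invfM mulrACA mulfV ?mulr1 ?fact_neq0.
congr (_ / _); rewrite /falling big_ord_recl mulr0n subr0 mul1r.
elim: n => [|n IHn]; first by rewrite !big_ord0 mulr1.
rewrite !big_ord_recr /= -IHn exprSr mulrACA; congr (_ * _).
by rewrite mulrBr mulr1 mulrnAr mulfV.
Qed.

Lemma deg_log1p_ode n :
  deg_log1p lam n.+1 *+ n.+1 + deg_log1p lam n *+ n =
  (n == 0%N)%:R + lam * deg_log1p lam n.
Proof.
case: n => [|n]; rewrite !deg_log1pE.
  by rewrite big_ord0 mulr1n mulr0n mulr0 divr1.
rewrite big_ord_recr /= add0r factS natrM invfM [_^-1 / _]mulrC.
rewrite -[X in X + _ = _]mulr_natr -[_ * n.+2%:R]mulrA mulfVK ?pnatr_eq0 //.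
by rewrite mulrBr mulrBl mulr_natr mulrnAl subrK mulrA [lam * _]mulrC.
Qed.

Lemma deg_exp_log1p n :
  fps_comp (deg_exp lam 1) (fun i => (deg_log1p lam i)%:P) n = (n < 2)%N%:R.
Proof.
set g := fps_comp _ _.
have Dg : forall n, g n.+1 *+ n.+1 + g n *+ n = g n.
  apply: (fps_comp_exp_log _ lam%:P); [exact: deg_exp1_ode | by [] |].
  move=> m; rewrite -!polyCMn -polyCM -polyCD deg_log1p_ode polyCD polyCM.
  by rewrite polyC_natr.
have g0 : g 0%N = 1 by rewrite /g fps_comp0 // deg_exp0.
have g1 : g 1%N = 1 by have := Dg 0%N; rewrite g0 mulr0n addr0.
have mulrSI (p : {poly R}) k : p *+ k.+1 = 0 -> p = 0.
  by move/eqP; rewrite -scaler_nat scaler_eq0 pnatr_eq0 /= => /eqP.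
(* At index 1 the terms [g 1] cancel, leaving [g 2 *+ 2 = 0]; from then on each zero coefficient
   forces the next one to vanish. *)
have g2 k : g k.+2 = 0.
  elim: k => [|k IHk].
    have /(canRL (addrK _)) := Dg 1%N; rewrite mulr1n subrr; exact: mulrSI.
  have := Dg k.+2; rewrite IHk mul0rn addr0; exact: mulrSI.
by case: n => [|[|n]].
Qed.

End Degenerate.

Theorem theorem1 (R : realType) (lam : R) (n : nat) :
  falling lam%:P 'X n =
    \sum_(0 <= k < n.+1) deg_stirling1 lam n k *: deg_bell lam k.
Proof.
pose u := fps_sub (deg_exp lam 1) (fps_one {poly R}).
pose l i := (deg_log1p lam i)%:P.
have u0 : u 0%N = 0 by rewrite /u /fps_sub deg_exp0 subrr.
have ul : fps_comp u l =1 fun i => (i == 1%N)%:R.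
  move=> i; rewrite fps_comp_sub fps_comp_one deg_exp_log1p /fps_one.
  by case: i => [|[|i]]; rewrite ?subrr ?subr0.
have : deg_exp lam 'X n = fps_comp (fps_comp (deg_exp lam 'X) u) l n.
  by rewrite fps_compA // (eq_fps_compr _ _ _ _ ul) fps_compX.
move/(congr1 (fun p => n`!%:R *: p)).
rewrite {1}/deg_exp scalerA mulfV ?fact_neq0 // scale1r => ->.
(* Only the outer composite is expanded; the inner one holds the coefficients of the Bell series.
   The [k!] in [deg_bell] then cancels the [1/k!] in [deg_stirling1]. *)
rewrite /fps_comp -/(fps_comp _ u) scaler_sumr big_mkord.
apply: eq_bigr => k _; rewrite /deg_bell /deg_stirling1 -/u scalerA.
rewrite fps_exp_polyC [_ * _%:P]mulrC mul_polyC scalerA; congr (_ *: _).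
by rewrite -mulrA; congr (_ * _); rewrite mulrAC mulVf ?mul1r ?fact_neq0.
Qed.
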